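(* Let $X_1,\dots,X_n\in\mathbb{R}^p$ be i.i.d. and $Y_1,\dots,Y_n\in\mathbb{R}^p$ be i.i.d., satisfying the standing assumptions listed in the context. Let $D$ be a deterministic $n\times n$ diagonal matrix with positive diagonal entries $R_1,\dots,R_n$, and let $A$ be a deterministic positive definite $p\times p$ matrix with $A\succeq t\,\mathrm{Id}_p$ for some $t>0$. For a given deterministic vector $x\in\mathbb{R}^p$ let $f(X)=x^\top(X^\top D^2X/n+A)^{-1}x$, and define $f(Y)$ in the same way with $Y$ in place of $X$. Then $$\left|\mathbb{E}[f(X)-f(Y)]\right|\le\sum_{j=1}^n\big(U_j(X_j)+U_j(Y_j)\big),$$ where $$U_j(X_j)\le\left(\frac{R_j^4}{n^{3/2}}\,\frac{x^\top A^{-1}x}{t^2}\sqrt{b_L(4;X_j)}\sqrt{\frac{b_{Q_2}(2;X_j)}{n}}\right)\wedge\left(\frac{R_j^2}{n}\,\frac{x^\top A^{-1}x}{t}\,b_L(2;X_j)\right),$$ and $U_j(Y_j)$ satisfies the same bound with $Y_j$ in place of $X_j$.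
   Context: Notation: $X$ (resp. $Y$) is the $n\times p$ matrix whose $i$-th row is $X_i^\top$ (resp. $Y_i^\top$), so $X^\top D^2X/n=\frac1n\sum_iR_i^2X_iX_i^\top$. $a\wedge b=\min(a,b)$; $\succeq$ is the Loewner order; $\|\cdot\|_{op}$ is the operator norm. Standing assumptions: the ratio $p/n$ stays bounded away from $0$ and $\infty$; the $X_j$ are independent, the $Y_j$ are independent, and the $Y_j$'s are independent of the $X_j$'s; for each $j$, $X_j$ and $Y_j$ have mean $0$ and the same covariance matrix $\Sigma_j$. For $Z\in\{X_j,Y_j\}$ and $k\ge1$, $b_L(k;Z)$ and $b_{Q_2}(k;Z)$ are deterministic numbers (finite for the exponents that appear) such that $\mathbb{E}|Z^\top v|^k\le b_L(k;Z)$ for every deterministic unit vector $v$, and $\mathbb{E}|Z^\top MZ-\mathbb{E}[Z^\top MZ]|^k\le b_{Q_2}(k;Z)$ for every deterministic positive semidefinite $M$ with $\|M\|_{op}\le1$. Without loss of generality $b_L(k;Z)\le\sqrt{b_L(2k;Z)}$. *)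

(* Defs.v *)
From HB Require Import structures.
From mathcomp Require Export all_boot all_order all_algebra.
From mathcomp Require Export all_classical all_reals all_analysis.

Set Implicit Arguments.
Unset Strict Implicit.
Unset Printing Implicit Defensive.

Import Order.TTheory GRing.Theory Num.Theory.
Import numFieldNormedType.Exports.

Local Open Scope classical_set_scope.
Local Open Scope ring_scope.

(* The library norm `|v| on matrices is the sup norm; the Euclidean norm and
   the operator norm it induces are needed here. *)
Definition norm2 (R : realType) (p : nat) (v : 'cV[R]_p) : R :=
  Num.sqrt (\sum_(i < p) v i 0 ^+ 2).

Definition opnorm (R : realType) (m p : nat) (M : 'M[R]_(m, p)) : R :=
  sup [set norm2 (M *m v) | v in [set v : 'cV[R]_p | norm2 v <= 1]].

Definition qform (R : realType) (p : nat) (M : 'M[R]_p) (v : 'cV[R]_p) : R :=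
  (v^T *m M *m v) 0 0.

Definition psdmx (R : realType) (p : nat) (M : 'M[R]_p) : Prop :=
  M \is symmetricmx /\ forall v : 'cV[R]_p, 0 <= qform M v.

Definition posdefmx (R : realType) (p : nat) (M : 'M[R]_p) : Prop :=
  M \is symmetricmx /\ forall v : 'cV[R]_p, v != 0 -> 0 < qform M v.

Definition loewner_le (R : realType) (p : nat) (M N : 'M[R]_p) : Prop :=
  psdmx (N - M).

(* Borel sets of the space of m x p matrices, i.e. the product sigma-algebra
   generated by the entries. *)
Definition mx_borel (R : realType) (m p : nat) : set (set 'M[R]_(m, p)) :=
  <<s [set B | exists (i : 'I_m) (j : 'I_p) (C : set R),
         measurable C /\ B = [set M : 'M[R]_(m, p) | C (M i j)]] >>.

Section RandomVectors.
Context (d : measure_display) (T : measurableType d) (R : realType)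
        (P : probability T R).

Definition random_vector (p : nat) (Z : T -> 'cV[R]_p) : Prop :=
  forall i : 'I_p, measurable_fun setT (fun w => Z w i 0).

Definition square_integrable_vec (p : nat) (Z : T -> 'cV[R]_p) : Prop :=
  forall i : 'I_p, P.-integrable setT (fun w => (Z w i 0%R ^+ 2)%R%:E).

Definition centered_vec (p : nat) (Z : T -> 'cV[R]_p) : Prop :=
  forall i : 'I_p, 'E_P[fun w => Z w i 0%R]%E = 0%E.

Definition has_covariance (p : nat) (Z : T -> 'cV[R]_p) (S : 'M[R]_p) : Prop :=
  forall i k : 'I_p,
    covariance P (fun w => Z w i 0) (fun w => Z w k 0) = (S i k)%:E.

(* Mutual independence of the whole family: subfamilies are covered by
   taking some of the B i equal to setT. *)
Definition independent_vecs (n p : nat) (X : 'I_n -> T -> 'cV[R]_p) : Prop :=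
  forall B : 'I_n -> set 'cV[R]_p, (forall i, mx_borel (B i)) ->
    P [set w | forall i, B i (X i w)]
    = (\prod_(i < n) fine (P (X i @^-1` B i)))%:E.

Definition identically_distributed (n p : nat)
    (X : 'I_n -> T -> 'cV[R]_p) : Prop :=
  forall (i j : 'I_n) (B : set 'cV[R]_p), mx_borel B ->
    P (X i @^-1` B) = P (X j @^-1` B).

Definition design (n p : nat) (X : 'I_n -> T -> 'cV[R]_p) (w : T)
  : 'M[R]_(n, p) := \matrix_(i < n, k < p) X i w k 0.

(* Independence of the joint families (X_1, ..., X_n) and (Y_1, ..., Y_n). *)
Definition independent_families (n p : nat)
    (X Y : 'I_n -> T -> 'cV[R]_p) : Prop :=
  forall B C : set 'M[R]_(n, p), mx_borel B -> mx_borel C ->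
    P ((design X @^-1` B) `&` (design Y @^-1` C))
    = (P (design X @^-1` B) * P (design Y @^-1` C))%E.

Definition linear_moment_bound (p : nat) (Z : T -> 'cV[R]_p) (k : nat)
    (b : \bar R) : Prop :=
  forall v : 'cV[R]_p, norm2 v = 1 ->
    ('E_P[fun w => (`|((Z w)^T *m v) 0 0| ^+ k)%R] <= b)%E.

Definition quadratic_moment_bound (p : nat) (Z : T -> 'cV[R]_p) (k : nat)
    (b : \bar R) : Prop :=
  forall M : 'M[R]_p, psdmx M -> opnorm M <= 1 ->
    let mu := fine ('E_P[fun w => qform M (Z w)])%E in
    ('E_P[fun w => (`|qform M (Z w) - mu| ^+ k)%R] <= b)%E.

End RandomVectors.

Definition ridge_form (R : realType) (n p : nat) (D : 'M[R]_n) (A : 'M[R]_p)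
    (x : 'cV[R]_p) (X : 'M[R]_(n, p)) : R :=
  qform (invmx (n%:R^-1 *: (X^T *m (D *m D) *m X) + A)) x.

Definition swap_bound (R : realType) (n p : nat) (r t : R) (A : 'M[R]_p)
    (x : 'cV[R]_p) (bL2 bL4 bQ2 : R) : R :=
  Num.min
    (r ^+ 4 / (n%:R `^ (3 / 2)) * (qform (invmx A) x / t ^+ 2)
       * Num.sqrt bL4 * Num.sqrt (bQ2 / n%:R))
    (r ^+ 2 / n%:R * (qform (invmx A) x / t) * bL2).

(* Main.v *)
From HB Require Import structures.
Require Import Defs.
From mathcomp Require Import ring lra measurable_realfun.
Import Order.TTheory GRing.Theory Num.Theory.
Import numFieldNormedType.Exports.
Local Open Scope classical_set_scope.
Local Open Scope ring_scope.
Set Implicit Arguments.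
Unset Strict Implicit.
Unset Printing Implicit Defensive.

(** The rows of the design are exchanged one at a time, in Lindeberg's way.
    [E f(X) - E f(Y)] telescopes over hybrid designs whose first [k] rows are
    [Y_i]'s and whose other rows are [X_i]'s. Two consecutive hybrids differ in
    a single row [j], which is independent of the others, so the others may be
    frozen and a bound that is uniform in their values is enough ([swap_row]).

    With these rows frozen, row [z] turns a fixed matrix [M >= A] (Loewner
    order) into [M + rho z z^T], [rho = R_j^2 / n], and by Sherman-Morrison
    lowers [x^T M^-1 x] by
      [rho (u^T z)^2 / (1 + rho q(z))],
    where [u = M^-1 x] and [q(z) = z^T M^-1 z]. Once [q(z)] is replaced by its
    mean [mu], a quadratic form in [z] divided by a constant is left. The mean
    of a quadratic form of a centered vector depends only on the covariance
    ([mean_qform]), so [mu] and the mean of this approximation are the same for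
    [X_j] and for [Y_j]: the approximations cancel, and only the two errors of
    freezing the denominator survive ([one_vector_swap]).

    Each error is at most [rho (u^T z)^2 min(1, rho |q(z) - mu|)] pointwise.
    The second moment of [u^T z] gives one bound on its mean, Cauchy-Schwarz
    between [(u^T z)^2] and [q(z) - mu] the other, and both hold at once, which
    produces the minimum ([rank1_drop_freeze]). The constants come from
    [M >= A >= t Id], which yields [|u|^2 <= x^T A^-1 x / t] and a positive
    semidefinite [t M^-1] of operator norm at most [1].

    Independence enters through [decoupled_law]: the law of a design with
    independent rows is unchanged when row [j] is read off an independent copy
    of the sample space. This is an equality of two measures on matrices, and
    it needs checking only on boxes of rows; Tonelli's theorem then integrates
    over row [j] first. *)

(** * Quadratic forms and positive definite matrices *)

Definition dot (R : realType) (p : nat) (u v : 'cV[R]_p) : R := (u^T *m v) 0 0.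

Section QuadraticForms.
Context (R : realType) (p : nat).
Implicit Types (u v x y z : 'cV[R]_p) (M N A : 'M[R]_p).

Lemma dotC u v : dot u v = dot v u.
Proof. by rewrite /dot -[LHS](mxE trmx_key (fun j i => (u^T *m v) i j)) -/(trmx _) trmx_mul trmxK. Qed.

Lemma dotE u v : dot u v = \sum_i u i 0 * v i 0.
Proof. by rewrite /dot mxE; apply: eq_bigr => i _; rewrite mxE. Qed.

Lemma dotDr u v w : dot u (v + w) = dot u v + dot u w.
Proof. by rewrite /dot mulmxDr mxE. Qed.

Lemma dotZr (a : R) u v : dot u (a *: v) = a * dot u v.
Proof. by rewrite /dot -scalemxAr mxE. Qed.

Lemma dotNr u v : dot u (- v) = - dot u v.
Proof. by rewrite -scaleN1r dotZr mulN1r. Qed.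

Lemma dotDl u v w : dot (u + v) w = dot u w + dot v w.
Proof. by rewrite dotC dotDr !(dotC w). Qed.

Lemma dotZl (a : R) u v : dot (a *: u) v = a * dot u v.
Proof. by rewrite dotC dotZr dotC. Qed.

Lemma dotNl u v : dot (- u) v = - dot u v.
Proof. by rewrite dotC dotNr dotC. Qed.

Lemma dot0r u : dot u 0 = 0.
Proof. by rewrite /dot mulmx0 mxE. Qed.

Lemma dot_ge0 u : 0 <= dot u u.
Proof. by rewrite dotE sumr_ge0// => i _; rewrite -expr2 sqr_ge0. Qed.

Lemma norm2E u : norm2 u = Num.sqrt (dot u u).
Proof. by rewrite /norm2 dotE; under eq_bigr do rewrite expr2. Qed.

Lemma norm2_sqr u : norm2 u ^+ 2 = dot u u.
Proof. by rewrite norm2E sqr_sqrtr ?dot_ge0. Qed.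

Lemma norm2Z (a : R) u : norm2 (a *: u) = `|a| * norm2 u.
Proof. by rewrite !norm2E dotZl dotZr mulrA -expr2 sqrtrM ?sqr_ge0// sqrtr_sqr. Qed.

Lemma norm2_eq0 u : norm2 u = 0 -> u = 0.
Proof.
move=> u0; have : dot u u = 0 by rewrite -norm2_sqr u0 expr0n.
rewrite dotE => /eqP; rewrite psumr_eq0; last by move=> i _; rewrite -expr2 sqr_ge0.
move=> /allP ui; apply/colP => i; rewrite mxE.
by have := ui i (mem_index_enum _); rewrite -expr2 sqrf_eq0 => /eqP.
Qed.

Lemma qformE M v : qform M v = dot v (M *m v).
Proof. by rewrite /qform /dot mulmxA. Qed.

Lemma qform_sum M v : qform M v = \sum_i \sum_k M i k * (v i 0 * v k 0).
Proof.
rewrite qformE dotE; apply: eq_bigr => i _; rewrite mxE mulr_sumr.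
by apply: eq_bigr => k _; ring.
Qed.

Lemma qformD M N v : qform (M + N) v = qform M v + qform N v.
Proof. by rewrite !qformE mulmxDl dotDr. Qed.

Lemma qformZ (a : R) M v : qform (a *: M) v = a * qform M v.
Proof. by rewrite !qformE -scalemxAl dotZr. Qed.

Lemma outer_mul z v : (z *m z^T) *m v = dot z v *: z.
Proof. by rewrite -mulmxA [z^T *m v]mx11_scalar mul_mx_scalar. Qed.

Lemma qform_outer z v : qform (z *m z^T) v = dot z v ^+ 2.
Proof. by rewrite qformE outer_mul dotZr (dotC v) expr2. Qed.

Lemma qform_scalar (a : R) v : qform a%:M v = a * dot v v.
Proof. by rewrite qformE mul_scalar_mx dotZr. Qed.

Lemma symmxP M : M \is symmetricmx -> M^T = M.
Proof.
move=> /is_hermitianmxP; rewrite expr0 scale1r => {2}->.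
by rewrite map_mx_id.
Qed.

Lemma symmxI M : M^T = M -> M \is symmetricmx.
Proof.
by move=> MT; apply/is_hermitianmxP; rewrite expr0 scale1r map_mx_id// MT.
Qed.

Lemma dot_symmx M u v : M \is symmetricmx -> dot u (M *m v) = dot (M *m u) v.
Proof. by move=> /symmxP MT; rewrite /dot trmx_mul MT mulmxA. Qed.

Lemma posdef_unit M : posdefmx M -> M \in unitmx.
Proof.
move=> [MT M0]; rewrite unitmxE unitfE; apply/det0P => -[v v0 vM].
have vT0 : v^T != 0 by apply: contra_neq v0 => /(congr1 trmx); rewrite trmxK trmx0.
by have := M0 _ vT0; rewrite /qform trmxK vM mul0mx mxE ltxx.
Qed.

Lemma posdef_le A M : posdefmx A -> M \is symmetricmx ->
  (forall v, qform A v <= qform M v) -> posdefmx M.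
Proof. by move=> [_ A0] MT AM; split=> // v /A0/lt_le_trans; apply. Qed.

Lemma posdef_ge0 M v : posdefmx M -> 0 <= qform M v.
Proof.
move=> [_ M0]; have [->|v0] := eqVneq v 0; last exact/ltW/M0.
by rewrite qformE mulmx0 dot0r.
Qed.

Lemma qform_invmxE M x : posdefmx M ->
  qform (invmx M) x = qform M (invmx M *m x).
Proof.
move=> Mp; have Mu := posdef_unit Mp.
by rewrite !qformE mulKVmx// dotC.
Qed.

Lemma qform_invmx_ge0 M x : posdefmx M -> 0 <= qform (invmx M) x.
Proof. by move=> Mp; rewrite qform_invmxE// posdef_ge0. Qed.

Lemma outer_sym (a : R) M z : M \is symmetricmx ->
  M + a *: (z *m z^T) \is symmetricmx.
Proof.
by move=> /symmxP MT; apply: symmxI; rewrite linearD/= MT linearZ/= trmx_mul trmxK.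
Qed.

Lemma qform_rank1_ge (a : R) M z v : 0 <= a ->
  qform M v <= qform (M + a *: (z *m z^T)) v.
Proof. by move=> a0; rewrite qformD qformZ qform_outer lerDl mulr_ge0 ?sqr_ge0. Qed.

Lemma invmx_sym M : M \is symmetricmx -> invmx M \is symmetricmx.
Proof. by move=> /symmxP MT; apply: symmxI; rewrite trmx_inv MT. Qed.

(** The inverse reverses the Loewner order: by duality
    [x^T M^-1 x = sup_y (2 y^T x - y^T M y)], so that a larger [M] gives a
    smaller supremum; only the maximizer [y = M^-1 x] enters the proof. *)
Lemma qform_invmx_le A M x : posdefmx A -> posdefmx M ->
  (forall v, qform A v <= qform M v) ->
  qform (invmx M) x <= qform (invmx A) x.
Proof.
move=> Ap Mp AM; have Au := posdef_unit Ap; have Mu := posdef_unit Mp.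
pose y := invmx M *m x; pose w := invmx A *m x.
have Aw : A *m w = x by rewrite mulKVmx.
have := posdef_ge0 (y - w) Ap; rewrite qformE mulmxBr Aw.
rewrite !(dotDl, dotDr, dotNl, dotNr).
rewrite (dot_symmx w y (proj1 Ap)) Aw -(qformE A).
have := AM y; rewrite -qform_invmxE// !qformE -/y -/w (dotC w x) (dotC y x).
by lra.
Qed.

Section Coercive.
Context (t : R) (M : 'M[R]_p).
Hypotheses (t_gt0 : 0 < t) (Mp : posdefmx M)
  (tM : forall v, t * dot v v <= qform M v).

(** For [y = M^-1 x], coercivity reads [t |y|^2 <= y^T M y = y^T x]. *)
Lemma dot_invmx_le x :
  dot (invmx M *m x) (invmx M *m x) <= qform (invmx M) x / t.
Proof. by rewrite ler_pdivlMr// mulrC qform_invmxE. Qed.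

(** Together with [opnorm_scaled_invmx]: [t M^-1] is an admissible matrix for a
    bound on the moments of quadratic forms. *)
Lemma psd_scaled_invmx : psdmx (t *: invmx M).
Proof.
split; last by move=> v; rewrite qformZ mulr_ge0 ?qform_invmx_ge0// ltW.
by apply: symmxI; rewrite linearZ/= (symmxP (invmx_sym (proj1 Mp))).
Qed.

Lemma opnorm_scaled_invmx : opnorm (t *: invmx M) <= 1.
Proof.
apply: ge_sup => [|_ [v /= v1 <-]].
  by exists (norm2 (t *: invmx M *m 0)); exists 0 => //=; rewrite norm2E dot0r sqrtr0 ler01.
apply: (le_trans _ v1); rewrite !norm2E ler_wsqrtr// -scalemxAl.
set y := invmx M *m v.
(* [|v|^2 - |t y|^2 = |v - t y|^2 + 2 t (y^T v - t |y|^2)] *)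
have := dot_ge0 (v - t *: y).
have : 0 <= t * (qform M y - t * dot y y).
  by rewrite mulr_ge0 ?subr_ge0 ?tM// ltW.
rewrite -qform_invmxE// qformE -/y.
rewrite !(dotDl, dotDr, dotNl, dotNr, dotZl, dotZr) (dotC y v).
by lra.
Qed.

End Coercive.

(** The Sherman-Morrison formula: correcting [M^-1 x] by a multiple of [M^-1 z]
    solves the perturbed system, and only the value of the quadratic form is
    needed. *)
Lemma qform_invmx_rank1 M (rho : R) x z : posdefmx M -> 0 <= rho ->
  posdefmx (M + rho *: (z *m z^T)) ->
  qform (invmx (M + rho *: (z *m z^T))) x =
  qform (invmx M) x
  - rho * dot (invmx M *m x) z ^+ 2 / (1 + rho * qform (invmx M) z).
Proof.
move=> Mp r0 Np; set N := M + _; have Mu := posdef_unit Mp.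
have d0 : 1 + rho * qform (invmx M) z != 0.
  by rewrite gt_eqF// ltr_pwDl// mulr_ge0// qform_invmx_ge0.
pose c := dot (invmx M *m x) z; pose q := qform (invmx M) z.
pose y := invmx M *m x - (rho * c / (1 + rho * q)) *: (invmx M *m z).
have Ny : N *m y = x.
  rewrite mulmxDl {1}/y mulmxBr mulKVmx// -scalemxAr mulKVmx//.
  rewrite -scalemxAl outer_mul /y dotDr dotNr dotZr (dotC z) -/c.
  rewrite -qformE -/q scalerA -addrA -[RHS]addr0; congr (_ + _).
  rewrite -scaleNr -scalerDl [X in X *: _](_ : _ = 0) ?scale0r//.
  by field.
have -> : qform (invmx N) x = dot x y.
  by rewrite qformE -{2}Ny mulKmx// posdef_unit.
rewrite /y dotDr dotNr dotZr -(qformE (invmx M)) (dot_symmx _ _ (invmx_sym (proj1 Mp))).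
by rewrite -/c -/q; congr (_ - _); ring.
Qed.

End QuadraticForms.

(** * Moments of a random vector *)

(** The power function with exponent [-1] is the inverse on nonnegative reals
    only, hence the detour through the square. *)
Lemma measurable_inv d (T : measurableType d) (R : realType) (f : T -> R) :
  measurable_fun setT f -> measurable_fun setT (fun w => (f w)^-1).
Proof.
move=> mf; have -> : (fun w => (f w)^-1) = fun w => f w * (f w ^+ 2) `^ (-1).
  apply/funext => w; rewrite powR_inv1 ?sqr_ge0//.
  have [->|f0] := eqVneq (f w) 0; first by rewrite invr0 mul0r.
  by field.
apply: measurable_funM => //.
have m2 : measurable_fun setT (fun w => f w ^+ 2) by exact: measurable_funX.
exact: (measurableT_comp (measurable_powR (-1)) m2).
Qed.

Section Moments.
Context (d : measure_display) (T : measurableType d) (R : realType)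
        (P : probability T R).
Implicit Types (f g : T -> R).

Lemma integrable_sumR I (r : seq I) (h : I -> T -> R) :
  (forall i, P.-integrable setT (EFin \o h i)) ->
  P.-integrable setT (EFin \o (fun w => \sum_(i <- r) h i w)).
Proof.
move=> ih; rewrite (_ : _ \o _ = fun w => (\sum_(i <- r) (h i w)%:E)%E).
  by apply: (integrable_sum measurableT r) => i _; exact: ih.
by apply/funext => w /=; rewrite sumEFin.
Qed.

Lemma Rintegral_sum I (r : seq I) (h : I -> T -> R) :
  (forall i, P.-integrable setT (EFin \o h i)) ->
  \int[P]_w (\sum_(i <- r) h i w) = \sum_(i <- r) \int[P]_w h i w.
Proof.
move=> ih; elim: r => [|i r IH].
  by rewrite big_nil; under eq_Rintegral do rewrite big_nil; rewrite Rintegral_cst// mul0r.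
rewrite big_cons -IH -RintegralD//; last exact: integrable_sumR.
by under eq_Rintegral do rewrite big_cons.
Qed.

Lemma integral_cauchy_schwarz f g (a b : R) :
  measurable_fun setT f -> measurable_fun setT g ->
  (\int[P]_w (f w ^+ 2)%:E <= a%:E)%E -> (\int[P]_w (g w ^+ 2)%:E <= b%:E)%E ->
  (\int[P]_w (`|f w * g w|)%:E <= (Num.sqrt a * Num.sqrt b)%:E)%E.
Proof.
move=> mf mg fa gb.
have N2 h c : (\int[P]_w (h w ^+ 2)%:E <= c%:E)%E ->
    ('N[P]_2%:E [EFin \o h] <= (Num.sqrt c)%:E)%E.
  move=> hc; rewrite unlock.
  rewrite (eq_integral (fun w => (h w ^+ 2)%:E)); last first.
    by move=> w _ /=; rewrite powR_mulrn// real_normK// num_real.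
  have i0 : (0 <= \int[P]_w (h w ^+ 2)%:E)%E.
    by apply: integral_ge0 => w _; rewrite lee_fin sqr_ge0.
  rewrite poweR12_sqrt//; apply: le_trans (_ : sqrte c%:E <= _)%E; last by [].
  by rewrite lee_sqrt// (le_trans i0).
have := @hoelder _ _ _ P f g 2 2 mf mg.
rewrite Lnorm1 => /(_ _ _ _)/le_trans; apply=> //; first by lra.
by rewrite EFinM; apply: lee_pmul; rewrite ?Lnorm_ge0 ?N2.
Qed.

Section Vector.
Context (p : nat) (Z : T -> 'cV[R]_p).
Hypotheses (mZ : random_vector Z) (sqZ : square_integrable_vec P Z).

Lemma measurable_dot u : measurable_fun setT (fun w => dot u (Z w)).
Proof.
under eq_fun do rewrite dotE.
by apply: measurable_sum => i; exact: measurable_funM.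
Qed.

Lemma measurable_qform N : measurable_fun setT (fun w => qform N (Z w)).
Proof.
under eq_fun do rewrite qform_sum.
apply: measurable_sum => i; apply: measurable_sum => k.
by apply: measurable_funM => //; exact: measurable_funM.
Qed.

Lemma integrable_entries i k :
  P.-integrable setT (EFin \o (fun w => Z w i 0 * Z w k 0)).
Proof.
have := integrableD measurableT (sqZ i) (sqZ k); apply: le_integrable => //=.
  by apply/measurable_EFinP; exact: measurable_funM.
move=> w _; rewrite lee_fin normrM [leRHS]ger0_norm ?addr_ge0 ?sqr_ge0//.
rewrite -[Z w i 0 ^+ 2]real_normK ?num_real// -[Z w k 0 ^+ 2]real_normK ?num_real//.
have := sqr_ge0 (`|Z w i 0| - `|Z w k 0|).
have := sqr_ge0 (`|Z w i 0|); have := sqr_ge0 (`|Z w k 0|).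
by rewrite sqrrB; lra.
Qed.

Lemma integrable_qform N : P.-integrable setT (EFin \o (fun w => qform N (Z w))).
Proof.
under [X in EFin \o X]eq_fun do rewrite qform_sum.
apply: integrable_sumR => i; apply: integrable_sumR => k.
exact: (integrableZl measurableT _ (integrable_entries i k)).
Qed.

(** The mean of a quadratic form of a centered vector depends on its law only
    through the covariance matrix; this is what makes two vectors with the
    same covariance exchangeable to second order. *)
Lemma mean_qform S N : centered_vec P Z -> has_covariance P Z S ->
  \int[P]_w qform N (Z w) = \sum_i \sum_k N i k * S i k.
Proof.
move=> cZ vZ; have ES i k : \int[P]_w (Z w i 0 * Z w k 0) = S i k.
  have := vZ i k; rewrite unlock !cZ/= unlock => ESik.
  rewrite /Rintegral (_ : (\int[P]_w _)%E = (S i k)%:E)//.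
  rewrite -ESik; apply: eq_integral => w _ /=.
  by rewrite /GRing.mul/= !subr0.
have iZ i k : P.-integrable setT (EFin \o (fun w => N i k * (Z w i 0 * Z w k 0))).
  exact: (integrableZl measurableT _ (integrable_entries i k)).
under eq_Rintegral do rewrite qform_sum.
rewrite Rintegral_sum => [|i]; last exact: integrable_sumR.
apply: eq_bigr => i _; rewrite Rintegral_sum//; apply: eq_bigr => k _.
by rewrite RintegralZl ?ES//; exact: integrable_entries.
Qed.

(** A unit vector exists as soon as [0 < p]; for [p = 0] the moment bound is
    vacuous and says nothing about [b]. *)
Lemma linear_moment_bound_ge0 k b : (0 < p)%N -> linear_moment_bound P Z k b ->
  (0 <= b)%E.
Proof.
case: p Z => // p' Z' _ /(_ (delta_mx 0 0)) bk.
apply: le_trans (bk _); first by apply: expectation_ge0 => w; rewrite exprn_ge0.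
rewrite /norm2 (bigD1 ord0)//= big1 => [|i i0].
  by rewrite mxE !eqxx expr1n addr0 sqrtr1.
by rewrite mxE (negbTE i0) expr0n.
Qed.

Lemma linear_moment_scaled k b u : (0 < k)%N -> b \is a fin_num ->
  linear_moment_bound P Z k b ->
  (\int[P]_w (`|dot u (Z w)| ^+ k)%:E <= (norm2 u ^+ k * fine b)%:E)%E.
Proof.
move=> k0 bfin bk; have [/norm2_eq0->|u0] := eqVneq (norm2 u) 0.
  rewrite norm2E dot0r sqrtr0 expr0n gtn_eqF// mul0r.
  rewrite (eq_integral (cst 0%E)) ?integral0// => w _.
  by rewrite dotC dot0r normr0 expr0n gtn_eqF.
have : 0 < norm2 u by rewrite lt_neqAle eq_sym u0 norm2E sqrtr_ge0.
pose s := norm2 u; rewrite -/s => s0.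
have us : norm2 (s^-1 *: u) = 1.
  by rewrite norm2Z ger0_norm ?invr_ge0 ?ltW// mulVf// gt_eqF.
have := bk _ us; rewrite unlock => bu.
rewrite (eq_integral (fun w => (s ^+ k)%:E * (`|((Z w)^T *m (s^-1 *: u)) 0 0| ^+ k)%:E)%E); last first.
  move=> w _; rewrite -EFinM -/(dot (Z w) _) dotZr dotC normrM exprMn.
  rewrite (ger0_norm (_ : 0 <= s^-1)) ?invr_ge0 ?ltW// mulrA -exprMn mulfV//.
  by rewrite expr1n mul1r.
rewrite ge0_integralZl//=.
- by rewrite EFinM fineK//; apply: lee_wpmul2l => //; rewrite lee_fin exprn_ge0// ltW.
- apply/measurable_EFinP/measurable_funX/measurableT_comp => //.
  by under eq_fun do rewrite -/(dot _ _) dotC; exact: measurable_dot.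
- by rewrite lee_fin exprn_ge0// ltW.
Qed.

Lemma quadratic_moment_scaled k b N (t : R) : 0 < t -> (0 < k)%N ->
  b \is a fin_num -> quadratic_moment_bound P Z k b ->
  psdmx (t *: N) -> opnorm (t *: N) <= 1 ->
  (\int[P]_w (`|qform N (Z w) - \int[P]_w qform N (Z w)| ^+ k)%:E
    <= (fine b / t ^+ k)%:E)%E.
Proof.
move=> t0 k0 bfin bk Npsd N1; have := bk _ Npsd N1; rewrite /= unlock.
have tk : 0 < t ^+ k by rewrite exprn_gt0.
set mu := \int[P]_w _.
have -> : fine (\int[P]_w (qform (t *: N) (Z w))%:E) = t * mu.
  rewrite -RintegralZl//; last exact: integrable_qform.
  by apply: eq_Rintegral => w _; rewrite qformZ.
rewrite (eq_integral (fun w => (t ^+ k)%:E * (`|qform N (Z w) - mu| ^+ k)%:E)%E); last first.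
  by move=> w _; rewrite -EFinM qformZ -mulrBr normrM exprMn (ger0_norm (ltW t0)).
rewrite ge0_integralZl//=; last 2 first.
- apply/measurable_EFinP/measurable_funX/measurableT_comp => //.
  by apply: measurable_funB => //; exact: measurable_qform.
- by rewrite lee_fin ltW.
by rewrite mulrC EFinM fineK// lee_pdivlMl.
Qed.

End Vector.
End Moments.

(** * Replacing one vector while the others are held fixed *)

Lemma inv1D_dist (R : realFieldType) (a b : R) : 0 <= a -> 0 <= b ->
  `|(1 + a)^-1 - (1 + b)^-1| <= Num.min 1 `|a - b|.
Proof.
move=> a0 b0; have a1 : 0 < 1 + a by rewrite ltr_pwDl.
have b1 : 0 < 1 + b by rewrite ltr_pwDl.
have in01 (y : R) : 0 <= y -> 0 <= (1 + y)^-1 <= 1.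
  by move=> y0; rewrite invr_ge0 invf_le1 ?ltr_pwDl// addr_ge0//= lerDl.
rewrite le_min; apply/andP; split.
  by have := in01 _ a0; have := in01 _ b0; rewrite ler_norml; lra.
have -> : (1 + a)^-1 - (1 + b)^-1 = (b - a) * ((1 + a)^-1 * (1 + b)^-1).
  by field; rewrite !gt_eqF.
rewrite normrM distrC ler_piMr// ger0_norm; last by rewrite mulr_ge0// invr_ge0 ltW.
by have /andP[? ?] := in01 _ a0; have /andP[? ?] := in01 _ b0; rewrite mulr_ile1.
Qed.

(** Since [n^(3/2) sqrt n = n^2], the rate is a power of [rho = r^2 / n]. *)
Lemma swap_rateE (R : realType) (n : nat) (r k t b4 bQ : R) :
  (0 < n)%N -> 0 < t ->
  r ^+ 4 / (n%:R `^ (3 / 2)) * (k / t ^+ 2) * Num.sqrt b4 * Num.sqrt (bQ / n%:R) =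
  (r ^+ 2 / n%:R) ^+ 2 * (k / t * Num.sqrt b4 * (Num.sqrt bQ / t)).
Proof.
move=> n_gt0 t0; have n0 : 0 < n%:R :> R by rewrite ltr0n.
have -> : 3 / 2 = 1 + 2^-1 :> R by field.
rewrite powRD ?gt_eqF ?implybT// powRr1 ?ltW// powR12_sqrt ?ltW//.
rewrite mulrC [bQ / _]mulrC sqrtrM ?invr_ge0 ?ltW// sqrtrV ?ltW//.
have s0 : 0 < Num.sqrt n%:R :> R by rewrite sqrtr_gt0.
have := sqr_sqrtr (ltW n0); move: s0; set s := Num.sqrt _ => s0 <-.
by field; rewrite !gt_eqF.
Qed.

(** [rank1_drop rho M x m z] with [m = qform (invmx M) z] is the decrease of
    [x^T M^-1 x] when [rho z z^T] is added to [M]; freezing [m] at a constant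
    makes it a quadratic form in [z]. *)
Definition rank1_drop (R : realType) (p : nat) (rho : R) (M : 'M[R]_p)
    (x : 'cV[R]_p) (m : R) (z : 'cV[R]_p) : R :=
  rho * dot (invmx M *m x) z ^+ 2 / (1 + rho * m).

Section OneVector.
Context (d : measure_display) (T : measurableType d) (R : realType)
        (P : probability T R) (n p : nat).
Context (A M : 'M[R]_p) (t r : R) (x : 'cV[R]_p).
Hypotheses (n_gt0 : (0 < n)%N) (p_gt0 : (0 < p)%N) (t_gt0 : 0 < t)
  (Apd : posdefmx A) (Mpd : posdefmx M)
  (AM : forall v, qform A v <= qform M v)
  (tA : forall v, t * dot v v <= qform A v).

Let rho := r ^+ 2 / n%:R.
Let u := invmx M *m x.

Let rho_ge0 : 0 <= rho. Proof. by rewrite divr_ge0 ?sqr_ge0. Qed.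

Let tM v : t * dot v v <= qform M v. Proof. exact: le_trans (tA v) (AM v). Qed.

Let norm_u : norm2 u ^+ 2 <= qform (invmx A) x / t.
Proof.
rewrite norm2_sqr (le_trans (dot_invmx_le t_gt0 Mpd tM x))//.
by rewrite ler_pM2r ?invr_gt0//; exact: qform_invmx_le.
Qed.

Section Linearization.
Context (Z : T -> 'cV[R]_p) (b2 b4 bQ : \bar R).
Hypotheses (mZ : random_vector Z) (sqZ : square_integrable_vec P Z).
Let q w := qform (invmx M) (Z w).
Let mu := \int[P]_w q w.

Let q_ge0 w : 0 <= q w. Proof. exact: qform_invmx_ge0. Qed.

Let mu_ge0 : 0 <= mu.
Proof. by apply: Rintegral_ge0 => w _; exact: q_ge0. Qed.

Lemma integrable_sqr_dot v : P.-integrable setT (EFin \o (fun w => dot v (Z w) ^+ 2)).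
Proof.
by under [X in EFin \o X]eq_fun do rewrite -qform_outer; exact: integrable_qform.
Qed.

Lemma measurable_rank1_drop (m : T -> R) : measurable_fun setT m ->
  measurable_fun setT (fun w => rank1_drop rho M x (m w) (Z w)).
Proof.
move=> mm; apply: measurable_funM.
  by apply: measurable_funM => //; apply: measurable_funX; exact: measurable_dot.
by apply/measurable_inv/measurable_funD => //; exact: measurable_funM.
Qed.

Lemma integrable_rank1_drop (m : T -> R) : measurable_fun setT m ->
  (forall w, 0 <= m w) ->
  P.-integrable setT (EFin \o (fun w => rank1_drop rho M x (m w) (Z w))).
Proof.
move=> mm m0.
have := integrableZl measurableT rho (integrable_sqr_dot u).
apply: le_integrable => //.
  by apply/measurable_EFinP; exact: measurable_rank1_drop.
move=> w _; rewrite lee_fin /rank1_drop [leLHS]normrM ler_piMr//.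
have m1 : 1 <= 1 + rho * m w by rewrite lerDl mulr_ge0.
by rewrite ger0_norm ?invr_ge0 ?invf_le1 ?(lt_le_trans ltr01)// (le_trans ler01).
Qed.

(** Both bounds rest on [|1/(1+a) - 1/(1+b)| <= min(1, |a-b|)] with
    [a = rho q], [b = rho mu]. The [1] leaves the second moment of the linear
    form [u^T Z]; the [|a-b|] leaves the product of [(u^T Z)^2] with the
    fluctuation of the quadratic form [q], to be split by Cauchy-Schwarz. *)
Lemma rank1_drop_freeze :
  b2 \is a fin_num -> b4 \is a fin_num -> bQ \is a fin_num ->
  linear_moment_bound P Z 2 b2 -> linear_moment_bound P Z 4 b4 ->
  quadratic_moment_bound P Z 2 bQ ->
  (\int[P]_w (`|rank1_drop rho M x (q w) (Z w) - rank1_drop rho M x mu (Z w)|)%:E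
   <= (swap_bound n r t A x (fine b2) (fine b4) (fine bQ))%:E)%E.
Proof.
move=> f2 f4 fQ B2 B4 BQ.
have mq : measurable_fun setT q by exact: measurable_qform.
have mD : measurable_fun setT (fun w =>
    `|rank1_drop rho M x (q w) (Z w) - rank1_drop rho M x mu (Z w)|).
  apply: measurableT_comp => //.
  by apply: measurable_funB; exact: measurable_rank1_drop.
have mc2 : measurable_fun setT (fun w => dot u (Z w) ^+ 2).
  by apply: measurable_funX; exact: measurable_dot.
have mc1 : measurable_fun setT (fun w => (`|dot u (Z w)| ^+ 2)%:E).
  apply/measurable_EFinP/measurable_funX/measurableT_comp => //.
  exact: measurable_dot.
have bnd w : `|rank1_drop rho M x (q w) (Z w) - rank1_drop rho M x mu (Z w)|
    <= rho * dot u (Z w) ^+ 2 * Num.min 1 (rho * `|q w - mu|).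
  rewrite /rank1_drop -mulrBr normrM -/u.
  have nn : 0 <= rho * dot u (Z w) ^+ 2 by rewrite mulr_ge0// sqr_ge0.
  rewrite ger0_norm//; apply: ler_wpM2l => //.
  have := inv1D_dist (mulr_ge0 rho_ge0 (q_ge0 w)) (mulr_ge0 rho_ge0 mu_ge0).
  by rewrite -mulrBr normrM (ger0_norm rho_ge0).
have k0 : 0 <= qform (invmx A) x / t.
  by apply: le_trans norm_u; rewrite sqr_ge0.
rewrite /swap_bound EFin_min le_min; apply/andP; split; last first.
- apply: (@le_trans _ _ (\int[P]_w (rho%:E * (`|dot u (Z w)| ^+ 2)%:E))%E).
    apply: ge0_le_integral => //.
    + exact/measurable_EFinP.
    + exact: measurable_funeM.
    + move=> w _; rewrite -EFinM lee_fin (le_trans (bnd w))//.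
      by rewrite real_normK ?num_real// ler_piMr ?ge_min ?lexx// mulr_ge0// sqr_ge0.
  rewrite ge0_integralZl//.
  have /(lee_wpmul2l (_ : 0 <= rho%:E)%E) := linear_moment_scaled mZ u (ltn0Sn _) f2 B2.
  rewrite lee_fin => /(_ rho_ge0)/le_trans; apply.
  rewrite -EFinM lee_fin -/rho -mulrA; apply: ler_wpM2l => //.
  apply: ler_wpM2r norm_u; apply: fine_ge0.
  exact: linear_moment_bound_ge0 B2.
- apply: (@le_trans _ _ (\int[P]_w ((rho ^+ 2)%:E *
      (`|dot u (Z w) ^+ 2 * (q w - mu)|)%:E))%E).
    apply: ge0_le_integral => //.
    + exact/measurable_EFinP.
    + apply: measurable_funeM; apply/measurable_EFinP/measurableT_comp => //.
      by apply: measurable_funM => //; exact: measurable_funB.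
    + move=> w _; rewrite -EFinM lee_fin (le_trans (bnd w))//.
      rewrite normrM (ger0_norm (sqr_ge0 _)).
      rewrite [leRHS](_ : _ = rho * dot u (Z w) ^+ 2 * (rho * `|q w - mu|)); last by ring.
      by apply: ler_wpM2l; [rewrite mulr_ge0 ?sqr_ge0|rewrite ge_min lexx orbT].
  rewrite ge0_integralZl//; last first.
  - by rewrite lee_fin exprn_ge0.
  - apply/measurable_EFinP/measurableT_comp => //.
    by apply: measurable_funM => //; exact: measurable_funB.
  have c4 : (\int[P]_w ((dot u (Z w) ^+ 2) ^+ 2)%:E <= (norm2 u ^+ 4 * fine b4)%:E)%E.
    have := linear_moment_scaled mZ u (ltn0Sn _) f4 B4.
    rewrite (eq_integral (fun w => ((dot u (Z w) ^+ 2) ^+ 2)%:E))// => w _.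
    by rewrite -(real_normK (num_real (dot u (Z w)))) -exprM.
  have q2 : (\int[P]_w ((q w - mu) ^+ 2)%:E <= (fine bQ / t ^+ 2)%:E)%E.
    have := quadratic_moment_scaled mZ sqZ t_gt0 (ltn0Sn _) fQ BQ
      (psd_scaled_invmx t_gt0 Mpd) (opnorm_scaled_invmx t_gt0 Mpd tM).
    rewrite (eq_integral (fun w => ((q w - mu) ^+ 2)%:E))// => w _.
    by rewrite real_normK ?num_real.
  have := integral_cauchy_schwarz mc2 (measurable_funB mq (measurable_cst mu)) c4 q2.
  move=> /(lee_wpmul2l (_ : 0 <= (rho ^+ 2)%:E)%E).
  rewrite lee_fin exprn_ge0// => /(_ isT)/le_trans; apply.
  rewrite -EFinM lee_fin.
  rewrite swap_rateE// -/rho; apply: ler_wpM2l; first by rewrite exprn_ge0.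
  have s4 : norm2 u ^+ 4 = (norm2 u ^+ 2) ^+ 2 by rewrite -exprM.
  have -> : Num.sqrt (norm2 u ^+ 4 * fine b4) = norm2 u ^+ 2 * Num.sqrt (fine b4).
    by rewrite s4 sqrtrM ?sqr_ge0// sqrtr_sqr ger0_norm// sqr_ge0.
  have -> : Num.sqrt (fine bQ / t ^+ 2) = Num.sqrt (fine bQ) / t.
    by rewrite mulrC sqrtrM ?invr_ge0 ?sqr_ge0// -exprVn sqrtr_sqr ger0_norm ?invr_ge0 ?ltW// mulrC.
  apply: ler_wpM2r; first by rewrite divr_ge0 ?sqrtr_ge0// ltW.
  by apply: ler_wpM2r; rewrite ?sqrtr_ge0.
Qed.

End Linearization.
Let f (z : 'cV[R]_p) := qform (invmx (M + rho *: (z *m z^T))) x.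

(** With the denominator frozen at the common mean [mu], the means for [X] and
    [Y] coincide, being determined by the covariance [S]; each vector then
    contributes only its own freezing error. *)
Lemma one_vector_swap (X Y : T -> 'cV[R]_p) (S : 'M[R]_p)
    (a2 a4 aQ b2 b4 bQ : \bar R) :
  random_vector X -> random_vector Y ->
  square_integrable_vec P X -> square_integrable_vec P Y ->
  centered_vec P X -> centered_vec P Y ->
  has_covariance P X S -> has_covariance P Y S ->
  a2 \is a fin_num -> a4 \is a fin_num -> aQ \is a fin_num ->
  b2 \is a fin_num -> b4 \is a fin_num -> bQ \is a fin_num ->
  linear_moment_bound P X 2 a2 -> linear_moment_bound P X 4 a4 ->
  quadratic_moment_bound P X 2 aQ ->
  linear_moment_bound P Y 2 b2 -> linear_moment_bound P Y 4 b4 ->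
  quadratic_moment_bound P Y 2 bQ ->
  `| \int[P]_w f (X w) - \int[P]_w f (Y w) | <=
    swap_bound n r t A x (fine a2) (fine a4) (fine aQ) +
    swap_bound n r t A x (fine b2) (fine b4) (fine bQ).
Proof.
move=> mX mY sX sY cX cY vX vY fa2 fa4 faQ fb2 fb4 fbQ X2 X4 XQ Y2 Y4 YQ.
pose mu := \int[P]_w qform (invmx M) (X w).
have muY : \int[P]_w qform (invmx M) (Y w) = mu.
  by rewrite (mean_qform mY sY _ cY vY) /mu (mean_qform mX sX _ cX vX).
pose frozen Z := \int[P]_w rank1_drop rho M x mu (Z w).
have frozenXY : frozen X = frozen Y.
  have E Z : random_vector Z -> square_integrable_vec P Z -> centered_vec P Z ->
      has_covariance P Z S ->
      frozen Z = rho / (1 + rho * mu) * \sum_i \sum_k (u *m u^T) i k * S i k.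
    move=> mZ sZ cZ vZ; rewrite -(mean_qform mZ sZ _ cZ vZ).
    rewrite -RintegralZl//; last exact: integrable_qform.
    by apply: eq_Rintegral => w _; rewrite qform_outer /rank1_drop -/u; ring.
  by rewrite (E X)// (E Y).
have drop Z (c2 c4 cQ : \bar R) : random_vector Z -> square_integrable_vec P Z ->
    \int[P]_w qform (invmx M) (Z w) = mu ->
    c2 \is a fin_num -> c4 \is a fin_num -> cQ \is a fin_num ->
    linear_moment_bound P Z 2 c2 -> linear_moment_bound P Z 4 c4 ->
    quadratic_moment_bound P Z 2 cQ ->
    `| \int[P]_w f (Z w) - (qform (invmx M) x - frozen Z) |
      <= swap_bound n r t A x (fine c2) (fine c4) (fine cQ).
  move=> mZ sZ muZ f2 f4 fQ Z2 Z4 ZQ.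
  have mu0 : 0 <= mu by apply: Rintegral_ge0 => w _; exact: qform_invmx_ge0.
  have ih := integrable_rank1_drop mZ sZ (measurable_qform mZ (invmx M))
    (fun w => qform_invmx_ge0 (Z w) Mpd).
  have ih' := integrable_rank1_drop mZ sZ (measurable_cst mu) (fun=> mu0).
  have -> : \int[P]_w f (Z w) = qform (invmx M) x
      - \int[P]_w rank1_drop rho M x (qform (invmx M) (Z w)) (Z w).
    have <- : \int[P]_w qform (invmx M) x = qform (invmx M) x.
      by rewrite Rintegral_cst//= (_ : P setT = 1%E) ?mulr1//; exact: probability_setT.
    rewrite -RintegralB//; last exact: finite_measure_integrable_cst.
    apply: eq_Rintegral => w _; rewrite /f qform_invmx_rank1//.
    apply: (posdef_le Mpd) => [|v]; first exact: outer_sym (proj1 Mpd).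
    exact: qform_rank1_ge.
  rewrite opprB addrC addrA subrK distrC -RintegralB//.
  apply: le_trans (le_normr_Rintegral measurableT _) _.
    exact: (integrableB measurableT ih ih').
  have := rank1_drop_freeze mZ sZ f2 f4 fQ Z2 Z4 ZQ; rewrite muZ => le_sb.
  have i0 : (0 <= \int[P]_w (`|rank1_drop rho M x (qform (invmx M) (Z w)) (Z w)
      - rank1_drop rho M x mu (Z w)|)%:E)%E.
    by apply: integral_ge0 => w _; rewrite lee_fin.
  rewrite -lee_fin /Rintegral fineK// ge0_fin_numE//.
  by apply: le_lt_trans le_sb _; rewrite ltry.
have := drop _ _ _ _ mX sX erefl fa2 fa4 faQ X2 X4 XQ.
have := drop _ _ _ _ mY sY muY fb2 fb4 fbQ Y2 Y4 YQ.
rewrite frozenXY !ler_norml; lra.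
Qed.

End OneVector.

(** * Independent rows and decoupling *)

Definition mx_entries (R : realType) (m p : nat) : set (set 'M[R]_(m, p)) :=
  [set B | exists (i : 'I_m) (j : 'I_p) (C : set R),
     measurable C /\ B = [set M : 'M[R]_(m, p) | C (M i j)]].

(** A copy of the matrix type on which [mx_borel] is the inferred
    sigma-algebra. *)
Definition borel_mx (R : realType) (m p : nat) := g_sigma_algebraType (@mx_entries R m p).

Definition row_vec (R : realType) (n p : nat) (M : 'M[R]_(n, p)) (i : 'I_n) : 'cV[R]_p :=
  (row i M)^T.

Definition put_row (R : realType) (n p : nat) (j : 'I_n) (z : 'cV[R]_p)
    (M : 'M[R]_(n, p)) : 'M[R]_(n, p) :=
  \matrix_(i, k) if i == j then z k 0 else M i k.

Definition row_box (R : realType) (n p : nat) (B : 'I_n -> set 'cV[R]_p) :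
    set 'M[R]_(n, p) :=
  [set M | forall i, B i (row_vec M i)].

Definition row_boxes (R : realType) (n p : nat) : set (set 'M[R]_(n, p)) :=
  [set row_box B | B in [set B | forall i, mx_borel (B i)]].

Section BorelMatrices.
Context (R : realType).

Lemma mx_borelT (m p : nat) : mx_borel (setT : set 'M[R]_(m, p)).
Proof. exact: (@measurableT _ (borel_mx R m p)). Qed.

Lemma measurable_entry (m p : nat) (i : 'I_m) (j : 'I_p) :
  measurable_fun setT (fun M : borel_mx R m p => M i j).
Proof.
by move=> _ C mC; rewrite setTI; apply: sub_sigma_algebra; exists i, j, C.
Qed.

Lemma measurable_to_borel_mx d (T : measurableType d) (m p : nat)
    (f : T -> borel_mx R m p) :
  (forall i j, measurable_fun setT (fun w => f w i j)) -> measurable_fun setT f.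
Proof.
move=> mf; apply: (@measurability _ _ T (borel_mx R m p) setT f (@mx_entries R m p) erefl).
move=> _ [_ [i [j [C [mC ->]]]] <-].
by rewrite setTI -[X in measurable X]setTI; exact: mf.
Qed.

Lemma measurable_row_vec (n p : nat) (i : 'I_n) :
  measurable_fun setT (fun M : borel_mx R n p => row_vec M i : borel_mx R p 1).
Proof.
apply: measurable_to_borel_mx => k l.
by under eq_fun do rewrite !mxE; exact: measurable_entry.
Qed.

Lemma measurable_row_box (n p : nat) (B : 'I_n -> set 'cV[R]_p) :
  (forall i, mx_borel (B i)) -> mx_borel (row_box B).
Proof.
move=> mB; rewrite (_ : row_box B = \bigcap_(i in setT)
    ((fun M : borel_mx R n p => row_vec M i) @^-1` (B i))); last first.
  by apply/seteqP; split => [M BM i _|M BM i]; [exact: BM|exact: BM i I].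
apply: (@fin_bigcap_measurable _ (borel_mx R n p)) => // i _.
rewrite -[X in measurable X]setTI.
by apply: (@measurable_row_vec n p i); rewrite ?mB//; exact: mB.
Qed.

(** A condition on the entry [(i, k)] is a box all of whose sides but the
    [i]-th are full. *)
Lemma row_boxes_gen (n p : nat) :
  @mx_borel R n p = <<s @row_boxes R n p >>.
Proof.
apply/seteqP; split; apply: smallest_sub.
- exact: smallest_sigma_algebra.
- move=> _ [i [k [C [mC ->]]]]; apply: sub_sigma_algebra.
  exists (fun i' => if i' == i then [set z : 'cV[R]_p | C (z k 0)] else setT).
    move=> i' /=; case: ifPn => _; last exact: mx_borelT.
    by apply: sub_sigma_algebra; exists k, 0, C.
  apply/seteqP; split => M /=.
    by move=> /(_ i); rewrite eqxx/= !mxE.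
  by move=> CM i'; case: ifPn => // /eqP ->; rewrite /= !mxE.
- exact: smallest_sigma_algebra.
- by move=> _ [B mB <-]; exact: measurable_row_box.
Qed.

Lemma row_boxes_setI (n p : nat) : setI_closed (@row_boxes R n p).
Proof.
move=> _ _ [B mB <-] [C mC <-]; exists (fun i => B i `&` C i).
  by move=> i /=; apply: (@measurableI _ (borel_mx R p 1)); [exact: mB|exact: mC].
apply/seteqP; split => M /=; first by move=> BC; split=> i; have [] := BC i.
by move=> [BM CM] i; split; [exact: BM|exact: CM].
Qed.

Lemma row_boxes_setT (n p : nat) : @row_boxes R n p setT.
Proof.
exists (fun=> setT); first by move=> i; exact: mx_borelT.
by apply/seteqP; split.
Qed.

End BorelMatrices.

Section Independence.
Context (d : measure_display) (T : measurableType d) (R : realType)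
        (P : probability T R) (n p : nat).
Implicit Types (X Y H : 'I_n -> T -> 'cV[R]_p).

Lemma row_vec_design H w i : row_vec (design H w) i = H i w.
Proof. by apply/colP => k; rewrite !mxE. Qed.

Lemma measurable_random_vector (Z : T -> 'cV[R]_p) : random_vector Z ->
  measurable_fun setT (Z : T -> borel_mx R p 1).
Proof. by move=> mZ; apply: measurable_to_borel_mx => i j; rewrite ord1. Qed.

Lemma measurable_design H : (forall i, random_vector (H i)) ->
  measurable_fun setT (design H : T -> borel_mx R n p).
Proof.
move=> mH; apply: measurable_to_borel_mx => i k.
by under eq_fun do rewrite mxE; exact: mH.
Qed.

Lemma probability_row_box H B : independent_vecs P H ->
  (forall i, mx_borel (B i)) ->
  P (design H @^-1` row_box B) = (\prod_i fine (P (H i @^-1` B i)))%:E.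
Proof.
move=> indH mB; rewrite -indH//; congr (P _).
by apply/seteqP; split => w /= BH i; move: (BH i); rewrite /= row_vec_design.
Qed.

(** A box for the mixed rows splits into a box for the [X_i]'s and one for the
    [Y_i]'s, with full sides where the other family is used: independence of
    the two families factors the probability, then independence within each
    family does. *)
Lemma independent_mix X Y (s : 'I_n -> bool) :
  independent_vecs P X -> independent_vecs P Y -> independent_families P X Y ->
  independent_vecs P (fun i => if s i then X i else Y i).
Proof.
move=> indX indY indXY B mB.
pose BX i := if s i then B i else setT; pose BY i := if s i then setT else B i.
have mBX i : mx_borel (BX i) by rewrite /BX; case: ifP => // _; exact: mx_borelT.
have mBY i : mx_borel (BY i) by rewrite /BY; case: ifP => // _; exact: mx_borelT.
transitivity (P ((design X @^-1` row_box BX) `&` (design Y @^-1` row_box BY))).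
  congr (P _); apply/seteqP; split => w /=.
    move=> BH; split=> i; rewrite row_vec_design; have := BH i.
      by rewrite /BX; case: ifP.
    by rewrite /BY; case: ifP.
  move=> [BXw BYw] i; have := BXw i; have := BYw i; rewrite !row_vec_design.
  by rewrite /BX /BY; case: ifP.
rewrite indXY; [|exact: measurable_row_box..].
rewrite !probability_row_box// -EFinM -big_split/=; congr (_%:E).
apply: eq_bigr => i _; rewrite /BX /BY; case: ifP => _.
  by rewrite preimage_setT probability_setT mulr1.
by rewrite preimage_setT probability_setT mul1r.
Qed.

Lemma measurable_put_row H H' j :
  (forall i, random_vector (H i)) -> (forall i, random_vector (H' i)) ->
  measurable_fun setT
    (fun w : T * T => put_row j (H j w.1) (design H' w.2) : borel_mx R n p).
Proof.
move=> mH mH'; apply: measurable_to_borel_mx => i k; under eq_fun do rewrite !mxE.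
case: (i == j).
  exact: (measurableT_comp (mH j k) measurable_fst).
exact: (measurableT_comp (mH' i k) measurable_snd).
Qed.

Lemma row_vec_put_row j z (M : 'M[R]_(n, p)) i :
  row_vec (put_row j z M) i = if i == j then z else row_vec M i.
Proof. by apply/colP => k; rewrite !mxE; case: ifP => _; rewrite ?mxE. Qed.

(** Both laws give a box of rows the product of the probabilities of its sides,
    and the boxes form a generating pi-system. *)
Lemma decoupled_law H j (B : set 'M[R]_(n, p)) :
  (forall i, random_vector (H i)) -> independent_vecs P H -> mx_borel B ->
  P (design H @^-1` B) =
  (P \x P)%E ((fun w => put_row j (H j w.1) (design H w.2)) @^-1` B).
Proof.
move=> mH indH mB.
have mD := measurable_design mH; have mS := measurable_put_row j mH mH.
pose D : {mfun T >-> borel_mx R n p} :=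
  HB.pack (design H) (isMeasurableFun.Build _ _ _ _ _ mD).
pose S : {mfun (T * T)%type >-> borel_mx R n p} :=
  HB.pack (fun w : T * T => put_row j (H j w.1) (design H w.2) : borel_mx R n p)
    (isMeasurableFun.Build _ _ _ _ _ mS).
apply: (@measure_unique _ R (borel_mx R n p) (@row_boxes R n p) (fun=> setT)
  _ _ _ _ (distribution P D) (distribution (P \x P)%E S)) => //.
- exact: row_boxes_gen.
- exact: row_boxes_setI.
- by move=> _; exact: row_boxes_setT.
- by rewrite bigcup_const//; exists 0%N.
- move=> _ [C mC <-].
  change (P (design H @^-1` row_box C) =
    (P \x P)%E ((fun w => put_row j (H j w.1) (design H w.2)) @^-1` row_box C)).
  pose C' i := if i == j then setT else C i.
  have mC' i : mx_borel (C' i) by rewrite /C'; case: ifP => // _; exact: mx_borelT.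
  have -> : (fun w => put_row j (H j w.1) (design H w.2)) @^-1` row_box C =
      (H j @^-1` C j) `*` (design H @^-1` row_box C').
    apply/seteqP; split => -[w w'] /=.
      move=> Cw; split; first by have := Cw j; rewrite row_vec_put_row eqxx.
      by move=> i; have := Cw i; rewrite row_vec_put_row /C'; case: ifP.
    move=> [Cw Cw'] i; rewrite row_vec_put_row; case: ifPn => [/eqP->//|ij].
    by have := Cw' i; rewrite /C' (negbTE ij).
  have mHj : measurable (H j @^-1` C j).
    rewrite -[X in measurable X]setTI.
    by apply: (measurable_random_vector (mH j)) => //; exact: mC.
  have mDC : measurable (design H @^-1` row_box C').
    by rewrite -[X in measurable X]setTI; apply: (measurable_design mH) => //; exact: measurable_row_box.
  rewrite product_measure1E// !probability_row_box//.
  transitivity (P (H j @^-1` C j) * P (design H @^-1` row_box C'))%E; last by [].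
  rewrite probability_row_box// (bigD1 j)//= [in RHS](bigD1 j)//= {1}/C' eqxx preimage_setT.
  rewrite probability_setT mul1r EFinM fineK; last exact: fin_num_measure.
  by congr (_ * (_)%:E)%E; apply: eq_bigr => i /negbTE ij; rewrite /C' ij.
- by move=> _; apply: (@le_lt_trans _ _ 1%E); [exact: probability_le1|rewrite ltry].
Qed.

Lemma decoupled_integral H j (g : 'M[R]_(n, p) -> R) :
  (forall i, random_vector (H i)) -> independent_vecs P H ->
  measurable_fun setT (g : borel_mx R n p -> R) -> (forall M, 0 <= g M) ->
  (\int[P]_w (g (design H w))%:E =
   \int[P]_w' \int[P]_w (g (put_row j (H j w) (design H w')))%:E)%E.
Proof.
move=> mH indH mg g0.
have mD := measurable_design mH; have mS := measurable_put_row j mH mH.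
have mgE : measurable_fun setT (EFin \o g : borel_mx R n p -> \bar R).
  exact/measurable_EFinP.
pose D : {mfun T >-> borel_mx R n p} :=
  HB.pack (design H) (isMeasurableFun.Build _ _ _ _ _ mD).
pose S : {mfun (T * T)%type >-> borel_mx R n p} :=
  HB.pack (fun w : T * T => put_row j (H j w.1) (design H w.2) : borel_mx R n p)
    (isMeasurableFun.Build _ _ _ _ _ mS).
have -> : (\int[P]_w (g (design H w))%:E = \int[distribution P D]_M (g M)%:E)%E.
  by rewrite ge0_integral_distribution// => M; rewrite lee_fin.
transitivity (\int[distribution (P \x P)%E S]_M (g M)%:E)%E.
  apply: eq_measure_integral => B mB _; exact: decoupled_law.
rewrite ge0_integral_distribution//.
rewrite fubini_tonelli2//; first exact: (measurableT_comp mgE mS).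
by move=> w; rewrite lee_fin.
Qed.

Lemma integrable_bounded (f : T -> R) (K : R) :
  measurable_fun setT f -> (forall w, 0 <= f w <= K) ->
  P.-integrable setT (EFin \o f).
Proof.
move=> mf fK; apply: (le_integrable measurableT _ _
  (finite_measure_integrable_cst P K measurableT)); first exact/measurable_EFinP.
move=> w _; rewrite lee_fin; have /andP[f0 fk] := fK w.
by rewrite !ger0_norm// (le_trans f0).
Qed.

(** One step of Lindeberg's replacement: by decoupling, both means are averages
    over the same frozen rows, so that the uniform bound [c] may be integrated
    under the average. *)
Lemma swap_row H H' j (g : 'M[R]_(n, p) -> R) (K c : R) :
  (forall i, random_vector (H i)) -> (forall i, random_vector (H' i)) ->
  independent_vecs P H -> independent_vecs P H' ->
  (forall i, i != j -> H i = H' i) ->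
  measurable_fun setT (g : borel_mx R n p -> R) -> (forall M, 0 <= g M <= K) ->
  (forall M, `| \int[P]_w g (put_row j (H j w) M)
              - \int[P]_w g (put_row j (H' j w) M) | <= c) ->
  `| \int[P]_w g (design H w) - \int[P]_w g (design H' w) | <= c.
Proof.
move=> mH mH' indH indH' HH' mg gK gc.
have g0 M : 0 <= g M by have /andP[] := gK M.
pose I (L : 'I_n -> T -> 'cV[R]_p) w' := \int[P]_w g (put_row j (L j w) (design H w')).
have IP L : (forall i, random_vector (L i)) -> independent_vecs P L ->
    (forall i, i != j -> L i = H i) ->
    P.-integrable setT (EFin \o I L) /\ \int[P]_w g (design L w) = \int[P]_w I L w.
  move=> mL indL LH.
  have mS := measurable_put_row j mL mH.
  have mgS w' : measurable_fun setT (fun w => g (put_row j (L j w) (design H w'))).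
    exact: (measurable_fun_pair1 w' (measurableT_comp mg mS)).
  have igS w' := integrable_bounded (mgS w') (fun=> gK _).
  have IE w' : (\int[P]_w (g (put_row j (L j w) (design H w')))%:E = (I L w')%:E)%E.
    by rewrite /I /Rintegral fineK// (integrable_fin_num measurableT (igS w')).
  have mI : measurable_fun setT (I L).
    apply/measurable_EFinP; rewrite (_ : EFin \o _ = fubini_G P
      (fun w => (g (put_row j (L j w.1) (design H w.2)))%:E)).
      apply: measurable_fun_fubini_tonelli_G => [|w]; last by rewrite lee_fin.
      by apply/measurable_EFinP; exact: (measurableT_comp mg mS).
    by apply/funext => w' /=; rewrite /fubini_G IE.
  split.
    apply: (@integrable_bounded _ K) => // w'; rewrite Rintegral_ge0//=.
    rewrite (_ : K = \int[P]_w K).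
      apply: le_Rintegral => //; first exact: finite_measure_integrable_cst.
      by move=> w _; have /andP[] := gK (put_row j (L j w) (design H w')).
    by rewrite Rintegral_cst//= (_ : P setT = 1%E) ?mulr1//; exact: probability_setT.
  rewrite /Rintegral (decoupled_integral j mL indL mg g0); congr fine.
  apply: eq_integral => w' _; rewrite -IE; apply: eq_integral => w _.
  congr (g _)%:E; apply/matrixP => i k; rewrite !mxE; case: ifPn => // ij.
  by rewrite LH.
have [iH ->] := IP H mH indH (fun _ _ => erefl).
have [iH' ->] := IP H' mH' indH' (fun i ij => esym (HH' i ij)).
rewrite -RintegralB//; apply: le_trans (le_normr_Rintegral measurableT _) _.
  exact: (integrableB measurableT iH iH').
rewrite (_ : c = \int[P]_w c); last first.
  by rewrite Rintegral_cst//= (_ : P setT = 1%E) ?mulr1//; exact: probability_setT.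
apply: le_Rintegral => //.
- exact: (integrable_norm (integrableB measurableT iH iH')).
- exact: finite_measure_integrable_cst.
- by move=> w _; exact: gc.
Qed.

End Independence.

(** * The ridge form as a function of the design *)

Section MeasurableInverse.
Context (d : measure_display) (T : measurableType d) (R : realType).

Lemma measurable_det (k : nat) (F : T -> 'M[R]_k) :
  (forall i j, measurable_fun setT (fun w => F w i j)) ->
  measurable_fun setT (fun w => \det (F w)).
Proof.
move=> mF; apply: measurable_sum => s; apply: measurable_funM => //.
by apply: measurable_prod => i _; exact: mF.
Qed.

(** By Cramer's rule the entries of the inverse are rational functions of the
    entries. *)
Lemma measurable_qform_invmx (k : nat) (F : T -> 'M[R]_k) (x : 'cV[R]_k) :
  (forall i j, measurable_fun setT (fun w => F w i j)) ->
  (forall w, F w \in unitmx) ->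
  measurable_fun setT (fun w => qform (invmx (F w)) x).
Proof.
move=> mF uF; rewrite (_ : (fun w => _) = fun w =>
    (\det (F w))^-1 * \sum_i \sum_j \adj (F w) i j * (x i 0 * x j 0)).
  apply: measurable_funM; first exact/measurable_inv/measurable_det.
  apply: measurable_sum => i; apply: measurable_sum => j.
  apply: measurable_funM => //; under eq_fun do rewrite mxE.
  apply: measurable_funM => //; apply: measurable_det => a b.
  by under eq_fun do rewrite !mxE; exact: mF.
by apply/funext => w; rewrite /invmx uF qformZ qform_sum.
Qed.

End MeasurableInverse.

Section RidgeForm.
Context (R : realType) (n p : nat) (r : 'rV[R]_n) (A : 'M[R]_p) (x : 'cV[R]_p).
Hypothesis Apd : posdefmx A.
Implicit Types (M : 'M[R]_(n, p)).

Let D := diag_mx r.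

Definition ridge_mx M : 'M[R]_p := n%:R^-1 *: (M^T *m (D *m D) *m M) + A.

Lemma ridge_formE M : ridge_form D A x M = qform (invmx (ridge_mx M)) x.
Proof. by []. Qed.

Lemma ridge_mxE M a b : ridge_mx M a b =
  n%:R^-1 * \sum_i r 0 i ^+ 2 * (M i a * M i b) + A a b.
Proof.
rewrite /ridge_mx !mxE; congr (_ * _ + _); apply: eq_bigr => i _.
rewrite mulmxA !mul_mx_diag !mxE; ring.
Qed.

Lemma ridge_mx_sym M : ridge_mx M \is symmetricmx.
Proof.
apply: symmxI; apply/matrixP => a b; rewrite mxE !ridge_mxE.
congr (_ * _ + _); last by rewrite -{1}(symmxP (proj1 Apd)) mxE.
by apply: eq_bigr => i _; rewrite (mulrC (M i b)).
Qed.

Lemma ridge_mx_ge M v : qform A v <= qform (ridge_mx M) v.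
Proof.
rewrite qformD qformZ lerDr mulr_ge0 ?invr_ge0//.
rewrite [leRHS](_ : _ = dot (D *m M *m v) (D *m M *m v)) ?dot_ge0//.
by rewrite /qform /dot !trmx_mul tr_diag_mx !mulmxA.
Qed.

Lemma ridge_mx_posdef M : posdefmx (ridge_mx M).
Proof. exact: posdef_le Apd (ridge_mx_sym M) (ridge_mx_ge M). Qed.

(** The Gram matrix is a sum over the rows; a zero row stands for the design
    with row [j] left out. *)
Lemma ridge_mx_put_row j z M : ridge_mx (put_row j z M) =
  ridge_mx (put_row j 0 M) + (r 0 j ^+ 2 / n%:R) *: (z *m z^T).
Proof.
apply/matrixP => a b; rewrite [RHS]mxE !ridge_mxE !(bigD1 j (P := xpredT))//=.
have -> : ((r 0 j ^+ 2 / n%:R) *: (z *m z^T)) a b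
    = n%:R^-1 * (r 0 j ^+ 2 * (z a 0 * z b 0)).
  by rewrite !mxE big_ord1 !mxE; ring.
have put_rowE z' i k : put_row j z' M i k = if i == j then z' k 0 else M i k.
  by rewrite mxE.
have other z' : \sum_(i < n | i != j) r 0 i ^+ 2 * (put_row j z' M i a * put_row j z' M i b)
    = \sum_(i < n | i != j) r 0 i ^+ 2 * (M i a * M i b).
  by apply: eq_bigr => i /negbTE ij; rewrite !put_rowE ij.
by rewrite !other !put_rowE eqxx !mxE; ring.
Qed.

Lemma measurable_ridge_form :
  measurable_fun setT (ridge_form D A x : borel_mx R n p -> R).
Proof.
apply: measurable_qform_invmx => [a b|M]; last exact: posdef_unit (ridge_mx_posdef M).
rewrite (_ : (fun M => _) = fun M : borel_mx R n p =>
    n%:R^-1 * \sum_i r 0 i ^+ 2 * (M i a * M i b) + A a b); last first.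
  by apply/funext => M; exact: ridge_mxE.
apply: measurable_funD => //; apply: measurable_funM => //.
apply: measurable_sum => i; apply: measurable_funM => //.
by apply: measurable_funM; exact: measurable_entry.
Qed.

Lemma ridge_form_bounds M : 0 <= ridge_form D A x M <= qform (invmx A) x.
Proof.
rewrite ridge_formE qform_invmx_ge0; last exact: ridge_mx_posdef.
exact: qform_invmx_le Apd (ridge_mx_posdef M) (ridge_mx_ge M).
Qed.

End RidgeForm.

(** * Lindeberg's replacement of the rows, one at a time *)

Theorem theorem3p2
  (d : measure_display) (T : measurableType d) (R : realType)
  (P : probability T R) (n p : nat)
  (c C : R) (hc : 0 < c) (hpn : c <= p%:R / n%:R <= C)
  (X Y : 'I_n -> T -> 'cV[R]_p)
  (mX : forall j, random_vector (X j)) (mY : forall j, random_vector (Y j))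
  (indepX : independent_vecs P X) (indepY : independent_vecs P Y)
  (indepXY : independent_families P X Y)
  (idX : identically_distributed P X) (idY : identically_distributed P Y)
  (sqX : forall j, square_integrable_vec P (X j))
  (sqY : forall j, square_integrable_vec P (Y j))
  (meanX : forall j, centered_vec P (X j))
  (meanY : forall j, centered_vec P (Y j))
  (Sigma : 'I_n -> 'M[R]_p)
  (covX : forall j, has_covariance P (X j) (Sigma j))
  (covY : forall j, has_covariance P (Y j) (Sigma j))
  (bL bQ2 : nat -> (T -> 'cV[R]_p) -> \bar R)
  (hbL : forall (j : 'I_n) (k : nat), (1 <= k)%N ->
     linear_moment_bound P (X j) k (bL k (X j)) /\
     linear_moment_bound P (Y j) k (bL k (Y j)))
  (hbQ2 : forall (j : 'I_n) (k : nat), (1 <= k)%N ->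
     quadratic_moment_bound P (X j) k (bQ2 k (X j)) /\
     quadratic_moment_bound P (Y j) k (bQ2 k (Y j)))
  (hbL_sqrt : forall (j : 'I_n) (k : nat), (1 <= k)%N ->
     (bL k (X j) <= sqrte (bL (2 * k)%N (X j)))%E /\
     (bL k (Y j) <= sqrte (bL (2 * k)%N (Y j)))%E)
  (finX : forall j, [/\ bL 2%N (X j) \is a fin_num, bL 4%N (X j) \is a fin_num
                      & bQ2 2%N (X j) \is a fin_num])
  (finY : forall j, [/\ bL 2%N (Y j) \is a fin_num, bL 4%N (Y j) \is a fin_num
                      & bQ2 2%N (Y j) \is a fin_num])
  (r : 'rV[R]_n) (r_gt0 : forall j, 0 < r 0 j)
  (A : 'M[R]_p) (Apd : posdefmx A)
  (t : R) (t_gt0 : 0 < t) (At : loewner_le t%:M A)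
  (x : 'cV[R]_p) :
  exists U : 'I_n -> (T -> 'cV[R]_p) -> R,
    (`| 'E_P[fun w => (ridge_form (diag_mx r) A x (design X w)
                       - ridge_form (diag_mx r) A x (design Y w))%R] |
       <= (\sum_(j < n) (U j (X j) + U j (Y j)))%R%:E)%E /\
    (forall j : 'I_n,
       U j (X j) <= swap_bound n (r 0 j) t A x (fine (bL 2%N (X j)))
                      (fine (bL 4%N (X j))) (fine (bQ2 2%N (X j))) /\
       U j (Y j) <= swap_bound n (r 0 j) t A x (fine (bL 2%N (Y j)))
                      (fine (bL 4%N (Y j))) (fine (bQ2 2%N (Y j)))).
Proof.
have n_gt0 : (0 < n)%N.
  case: n hpn {X Y mX mY indepX indepY indepXY idX idY sqX sqY meanX meanY Sigma
    covX covY hbL hbQ2 hbL_sqrt finX finY r r_gt0} => //.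
  by rewrite invr0 mulr0 => /andP[/(lt_le_trans hc)]; rewrite ltxx.
have p_gt0 : (0 < p)%N.
  rewrite lt0n; apply/eqP => p0; move: hpn; rewrite p0 mul0r => /andP[].
  by move=> /(lt_le_trans hc); rewrite ltxx.
have tA v : t * dot v v <= qform A v.
  have [_ /(_ v)] := At.
  by rewrite -scaleN1r qformD qformZ qform_scalar mulN1r subr_ge0.
(* The freezing error of each single vector is below the minimum of the two
   bounds, so the bound itself is a legitimate [U]. *)
pose b j Z := swap_bound n (r 0 j) t A x (fine (bL 2%N Z)) (fine (bL 4%N Z)) (fine (bQ2 2%N Z)).
exists b; split; last by move=> j; split.
pose g := ridge_form (diag_mx r) A x.
have mg := measurable_ridge_form r x Apd; have gK := ridge_form_bounds r x Apd.
(* In [H k] the first [k] rows are already replaced. *)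
pose H (k : nat) (i : 'I_n) := if (k <= i)%N then X i else Y i.
have mH k i : random_vector (H k i) by rewrite /H; case: ifP.
have indH k : independent_vecs P (H k) by exact: (independent_mix (fun i : 'I_n => (k <= i)%N)).
have step (j : 'I_n) : `| \int[P]_w g (design (H j) w) - \int[P]_w g (design (H j.+1) w) |
    <= b j (X j) + b j (Y j).
  apply: (swap_row (j := j) (mH j) (mH j.+1) (indH j) (indH j.+1) _ mg gK).
    by move=> i ij; rewrite /H ltn_neqAle eq_sym (_ : (i : nat) != j) .
  move=> M; rewrite /H leqnn ltnn.
  have [f2 f4 fQ] := finX j; have [f2' f4' fQ'] := finY j.
  rewrite /g; under eq_Rintegral do rewrite ridge_formE ridge_mx_put_row.
  under [X in _ - X]eq_Rintegral do rewrite ridge_formE ridge_mx_put_row.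
  have M0pd := ridge_mx_posdef r Apd (put_row j 0 M).
  have := one_vector_swap (r 0 j) x n_gt0 p_gt0 t_gt0 Apd M0pd
    (ridge_mx_ge r A (put_row j 0 M)) tA (mX j) (mY j) (sqX j) (sqY j)
    (meanX j) (meanY j) (covX j) (covY j) f2 f4 fQ f2' f4' fQ'
    (proj1 (hbL j 2%N isT)) (proj1 (hbL j 4%N isT)) (proj1 (hbQ2 j 2%N isT))
    (proj2 (hbL j 2%N isT)) (proj2 (hbL j 4%N isT)) (proj2 (hbQ2 j 2%N isT)).
  exact.
have igD k : P.-integrable setT (EFin \o (fun w => g (design (H k) w))).
  apply: (@integrable_bounded _ _ _ _ _ (qform (invmx A) x)) => [|w]; last exact: gK.
  exact: (measurableT_comp mg (measurable_design (mH k))).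
have H0 : H 0%N = X by [].
have Hn : H n = Y by apply/funext => i; rewrite /H leqNgt ltn_ord.
rewrite unlock -/g.
have -> : (\int[P]_w (g (design X w) - g (design Y w))%:E)%E =
    (\int[P]_w g (design (H 0%N) w) - \int[P]_w g (design (H n) w))%:E.
  rewrite -RintegralB// H0 Hn /Rintegral fineK//.
  apply: integrable_fin_num => //.
  by have := integrableB measurableT (igD 0%N) (igD n); rewrite H0 Hn.
rewrite lee_fin -opprB -(telescope_sumr (fun k => \int[P]_w g (design (H k) w)))//.
rewrite big_mkord normrN; apply: le_trans (ler_norm_sum _ _ _) _.
by apply: ler_sum => j _; rewrite distrC; exact: step.
Qed.
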